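(* Let $R$ be an associative unital ring, let $n$ be a positive integer and let $G$ be a group. Every very good $G$-grading on the matrix ring $M_n(R)$ is an epsilon-strong $G$-grading.
   Context: $M_n(R)$ is the ring of all $n\times n$ matrices with entries in $R$; $e_{i,j}$ denotes the matrix with $1$ in position $(i,j)$ and zeros elsewhere. The identity element of $G$ is $e$. A $G$-grading on a ring $S$ is a family of additive subgroups $S_g$ ($g\in G$) with $S=\bigoplus_{g\in G}S_g$ as additive groups and $S_gS_h\subseteq S_{gh}$ for all $g,h\in G$, where $S_gS_h$ denotes the set of all finite sums of products $st$ with $s\in S_g$, $t\in S_h$. A $G$-grading on $S=M_n(R)$ is very good if for all $i,j\in\{1,\ldots,n\}$ there is $g\in G$ with $Re_{i,j}\subseteq S_g$. A $G$-grading on $S$ is epsilon-strong (equivalently, $S$ is epsilon-strongly $G$-graded) if for every $g\in G$ there is some $\epsilon_g\in S_gS_{g^{-1}}$ such that $\epsilon_g s=s\epsilon_{g^{-1}}=s$ for every $s\in S_g$. *)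

(* Defs.v *)
From HB Require Import structures.
From mathcomp Require Import all_boot all_algebra.
From mathcomp Require Import boolp classical_sets.

Set Implicit Arguments.
Unset Strict Implicit.
Unset Printing Implicit Defensive.

Import GRing.Theory.
Local Open Scope ring_scope.
Local Open Scope classical_set_scope.

(* Rings are pzRingType, so the zero ring is allowed, and G : groupType is an
   arbitrary, possibly infinite, group.                                       *)

Definition direct_sum_decomposition (I : choiceType) (V : zmodType)
    (A : I -> set V) : Prop :=
  (forall x : V, exists (s : seq I) (f : I -> V),
      [/\ uniq s, (forall i, A i (f i)) & x = \sum_(i <- s) f i])
  /\ (forall (s : seq I) (f : I -> V),
      uniq s -> (forall i, A i (f i)) -> \sum_(i <- s) f i = 0 ->
      forall i, i \in s -> f i = 0).

(* The set of finite sums of products; the pointwise product set is in general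
   not closed under addition.                                                 *)
Definition prod_sums (S : pzRingType) (A B : set S) : set S :=
  [set x | exists (m : nat) (a b : 'I_m -> S),
     [/\ (forall k, A (a k)), (forall k, B (b k)) & x = \sum_(k < m) a k * b k]].

Definition grading (S : pzRingType) (G : groupType) (A : G -> set S) : Prop :=
  [/\ (forall g, zmod_closed [in A g]),
      direct_sum_decomposition A
    & forall g h, prod_sums (A g) (A h) `<=` A (g * h)%g].

Definition very_good_grading (R : pzRingType) (n : nat) (G : groupType)
    (A : G -> set 'M[R]_n) : Prop :=
  grading A /\
  forall i j : 'I_n, exists g : G,
    [set r *: delta_mx i j | r in [set: R]] `<=` A g.

Definition epsilon_strong_grading (S : pzRingType) (G : groupType)
    (A : G -> set S) : Prop :=
  grading A /\
  exists eps : G -> S,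
    (forall g, prod_sums (A g) (A g^-1%g) (eps g)) /\
    (forall g s, A g s -> eps g * s = s /\ s * eps g^-1%g = s).

(* Main.v *)
Require Import Defs.
From HB Require Import structures.
From mathcomp Require Import all_boot all_algebra.
From mathcomp Require Import boolp classical_sets.

Set Implicit Arguments.
Unset Strict Implicit.
Unset Printing Implicit Defensive.

Import GRing.Theory.
Local Open Scope ring_scope.

(** In a very good grading every matrix unit [e_ij] is homogeneous of some
    degree [d i j], and over a nonzero ring [d] is a cocycle:
    [d i k = d i j * d j k].  Since [e_ii] then has trivial degree, for [s] of
    degree [g] the matrix [e_ii s e_jj = s_ij e_ij] has both degree [g] and
    degree [d i j], so [s_ij = 0] unless [d i j = g].  Hence the sum of the
    [e_ii = e_ij e_ji] over those [i] for which some [j] has [d i j = g] works as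
    [epsilon_g]. *)

Section Grading.
Variables (S : pzRingType) (G : groupType) (A : G -> set S).
Hypothesis gradA : grading A.

Lemma grading0 g : A g 0.
Proof. by case: gradA => /(_ g)[+ _] _ _; rewrite inE. Qed.

Lemma gradingN g x : A g x -> A g (- x).
Proof.
case: gradA => /(_ g)[_ subA] _ _ Ax.
have := subA 0 x; rewrite !inE sub0r; apply=> //; exact: grading0.
Qed.

Lemma gradingM g h x y : A g x -> A h y -> A (g * h)%g (x * y).
Proof.
case: gradA => _ _ mulA Ax Ay; apply: mulA.
by exists 1%N, (fun=> x), (fun=> y); rewrite big_ord1.
Qed.

Lemma grading_degree_uniq g h x : x != 0 -> A g x -> A h x -> g = h.
Proof.
move=> x0 Agx Ahx; apply/eqP; apply: contraNT x0 => neq_gh; apply/eqP.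
case: gradA => _ [_ uniqA] _.
(* If [g] and [h] differed, the family with [x] in degree [g] and [- x] in degree [h] would sum to
   zero, and directness of the decomposition would force [x = 0]. *)
pose f k := if k == g then x else if k == h then - x else 0.
have neq_hg : h == g = false by rewrite eq_sym (negbTE neq_gh).
have := uniqA [:: g; h] f _ _ _ g; rewrite /f eqxx; apply.
- by rewrite /= inE neq_gh.
- move=> k; case: eqP => [->//|_]; case: eqP => [->|_]; first exact: gradingN.
  exact: grading0.
- by rewrite !big_cons big_nil /= eqxx neq_hg eqxx addr0 subrr.
- exact: mem_head.
Qed.

End Grading.

Lemma delta_mx_neq0 (R : pzRingType) m n (i : 'I_m) (j : 'I_n) :
  1 != 0 :> R -> delta_mx i j != 0 :> 'M[R]_(m, n).
Proof.
by apply: contraNneq => /matrixP/(_ i j); rewrite !mxE !eqxx => /eqP.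
Qed.

Section VeryGood.
Variables (R : pzRingType) (n : nat) (G : groupType) (A : G -> set 'M[R]_n).
Variable d : 'I_n -> 'I_n -> G.
Hypothesis gradA : grading A.
Hypothesis A_scale_delta : forall i j r, A (d i j) (r *: delta_mx i j).
Hypothesis R_nontrivial : 1 != 0 :> R.

Lemma A_delta i j : A (d i j) (delta_mx i j).
Proof. by rewrite -[delta_mx i j]scale1r. Qed.

(** The product of [delta_mx i j] and [delta_mx j k] is [delta_mx i k], which is nonzero because
    [1 != 0] and so has only one degree. *)
Lemma degreeM i j k : (d i j * d j k)%g = d i k.
Proof.
apply: (grading_degree_uniq gradA (delta_mx_neq0 i k R_nontrivial)).
  rewrite -(mul_delta_mx j); exact: (gradingM gradA (A_delta i j) (A_delta j k)).
exact: A_delta.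
Qed.

Lemma degree1 i : d i i = 1%g.
Proof. by apply: (mulgI (d i i)); rewrite degreeM mulg1. Qed.

Lemma degreeV i j : (d i j)^-1%g = d j i.
Proof. by apply: (mulgI (d i j)); rewrite mulgV degreeM degree1. Qed.

Lemma homogeneous_entry g s i j : A g s -> s i j != 0 -> d i j = g.
Proof.
move=> Ags sij0.
have eij : delta_mx i i * s * delta_mx j j = s i j *: delta_mx i j.
  apply/matrixP=> a b; rewrite !mxE (bigD1 j) //= big1 => [|c /negbTE cj]; last first.
    by rewrite !mxE cj mulr0.
  rewrite addr0 !mxE eqxx /= (bigD1 i) //= big1 => [|c /negbTE ci]; last first.
    by rewrite !mxE ci andbF mul0r.
  rewrite addr0 !mxE eqxx andbT.
  by case: (a == i); case: (b == j); rewrite ?(mul1r, mul0r, mulr1, mulr0).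
have neq0 : s i j *: delta_mx i j != 0 :> 'M_n.
  by apply: contraNneq sij0 => /matrixP/(_ i j); rewrite !mxE !eqxx mulr1 => ->.
(* Degree [d i j] requires all of [R e_ij] to lie in one component, since the coefficient here is
   [s i j] rather than 1. *)
apply: (grading_degree_uniq gradA neq0); first exact: A_scale_delta.
have := gradingM gradA (gradingM gradA (A_delta i i) Ags) (A_delta j j).
by rewrite eij !degree1 mul1g mulg1.
Qed.

Definition row_support g i := [exists j, d i j == g].

(** The diagonal form makes multiplication on the left scale rows and on the right scale columns. *)
Definition local_unit g : 'M[R]_n := diag_mx (\row_i (row_support g i)%:R).

Lemma local_unit_prod_sums g : prod_sums (A g) (A g^-1%g) (local_unit g).
Proof.
(* For [k] in the support, any [j] with [d k j = g] gives [e_kk = e_kj e_jk], with factors of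
   degrees [g] and [g^-1]; every other [k] contributes the product of two zeros. *)
pose a k := if [pick j | d k j == g] is Some j then delta_mx k j else 0 : 'M[R]_n.
pose b k := if [pick j | d k j == g] is Some j then delta_mx j k else 0 : 'M[R]_n.
exists n, a, b; split=> [k|k|].
- rewrite /a; case: pickP => [j /eqP<-|_]; [exact: A_delta | exact: grading0].
- rewrite /b; case: pickP => [j /eqP<-|_]; last exact: grading0.
  rewrite degreeV; exact: A_delta.
- rewrite /local_unit diag_mx_sum_delta; apply: eq_bigr => k _.
  rewrite mxE /a /b /row_support; case: pickP => [j dkj|no_j].
    rewrite (_ : [exists _, _]) ?scale1r; last by apply/existsP; exists j.
    by rewrite -[RHS]/(_ *m _) mul_delta_mx.
  rewrite (_ : [exists _, _] = false) ?scale0r ?mul0r //.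
  by apply/existsP=> -[j]; rewrite no_j.
Qed.

Lemma local_unit_mull g s : A g s -> local_unit g * s = s.
Proof.
move=> Ags; rewrite -[LHS]/(_ *m _) mul_diag_mx; apply/matrixP=> i j.
rewrite !mxE; have [->|sij0] := eqVneq (s i j) 0; first by rewrite mulr0.
rewrite (_ : row_support g i) ?mul1r //.
by apply/existsP; exists j; rewrite (homogeneous_entry Ags sij0).
Qed.

Lemma local_unit_mulr g s : A g s -> s * local_unit g^-1%g = s.
Proof.
move=> Ags; rewrite -[LHS]/(_ *m _) mul_mx_diag; apply/matrixP=> i j.
rewrite !mxE; have [->|sij0] := eqVneq (s i j) 0; first by rewrite mul0r.
rewrite (_ : row_support _ j) ?mulr1 //.
(* A nonzero entry [s i j] forces [d i j = g], hence [d j i = g^-1], so column [j] is kept. *)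
by apply/existsP; exists i; rewrite -degreeV (homogeneous_entry Ags sij0).
Qed.

End VeryGood.

Theorem theorem2p4 (R : pzRingType) (n : nat) (hn : (0 < n)%N) (G : groupType)
    (A : G -> set 'M[R]_n) :
  very_good_grading A -> epsilon_strong_grading A.
Proof.
move=> [gradA very_good]; split=> //.
(* Over the zero ring the matrix units vanish and have no unique degree. All matrices are then zero,
   and 0, as an empty sum of products, serves as every epsilon. *)
have [R0|R_nontrivial] := eqVneq (1 : R) 0.
  have M0 (x : 'M[R]_n) : x = 0.
    by apply/matrixP=> i j; rewrite mxE -[LHS]mulr1 R0 mulr0.
  exists (fun=> 0); split=> [g|g s _]; last by rewrite (M0 s) mulr0.
  by exists 0%N, (fun=> 0), (fun=> 0); split=> [[]|[]|] //; rewrite big_ord0.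
have [d Ad] : exists d : 'I_n -> 'I_n -> G,
    forall i j r, A (d i j) (r *: delta_mx i j).
  (* Choice is applied once, over pairs of indices, and the result is then curried. *)
  have /choice[d Ad] : forall ij : 'I_n * 'I_n, exists g : G,
      forall r, A g (r *: delta_mx ij.1 ij.2).
    by case=> i j; have [g Ag] := very_good i j; exists g => r; apply: Ag; exists r.
  by exists (fun i j => d (i, j)) => i j r; apply: (Ad (i, j)).
exists (local_unit R d); split=> [g|g s Ags].
  exact: local_unit_prod_sums.
split; [exact: (local_unit_mull gradA Ad)|exact: (local_unit_mulr gradA Ad)].
Qed.
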